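(* Let $(X,\rho)$ be a metric space and let $\mathcal{B}$ be a bornology on $X$ with a closed base. Then $$nw(X,\mathcal B)\le nw(\tau_{\mathcal B})\le w(X)^{<\delta(X,\mathcal B)}.$$
   Context: A bornology on a set $X$ is a family $\mathcal B$ of subsets of $X$ that is closed under taking subsets, closed under finite unions, and satisfies $\bigcup\mathcal B=X$. A base of $\mathcal B$ is a subfamily $\mathcal B_0\subset\mathcal B$ such that every $B\in\mathcal B$ is contained in some $B_0\in\mathcal B_0$; $\mathcal B$ has a closed base if it has a base consisting of closed sets (equivalently $\overline B\in\mathcal B$ for all $B\in\mathcal B$). A family $\gamma$ of subsets of $X$ is a $\mathcal B$-network on $X$ if for every $B\in\mathcal B$ and every open $U\supset\overline B$ there is $C\in\gamma$ with $\overline B\subset C\subset U$; $nw(X,\mathcal B)=\aleph_0+\min\{|\gamma|:\gamma\text{ is a }\mathcal B\text{-network on }X\}$. For a space $Y$, $\delta(Y)$ is $\aleph_0$ plus the least cardinal $\mathfrak m$ such that every open cover of $Y$ has a subcover of cardinality $<\mathfrak m$; $\delta(X,\mathcal B)=\sup\{\delta(\overline B):B\in\mathcal B\}$. For cardinals, $\kappa^{<\lambda}=\sup\{\kappa^{\mathfrak m}:\mathfrak m<\lambda\}$. $C(X)$ is the set of continuous functions $X\to\mathbb R$. The topology $\tau_{\mathcal B}$ on $C(X)$ is induced by the uniformity with basic entourages $[B,\epsilon]=\{(f,g):\forall x\in B,\ |f(x)-g(x)|<\epsilon\}$, where $B\in\mathcal B$, $\epsilon>0$. $w(X)$ is the weight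 of $X$ and $nw(\tau_{\mathcal B})$ is the network weight of $(C(X),\tau_{\mathcal B})$. Convention: all cardinal functions (in particular $w$ and $nw$) are taken to be infinite, i.e. $\aleph_0$ is added to their value. *)

(* Defs.v *)
From HB Require Import structures.
From mathcomp Require Import all_boot all_order all_algebra.
From mathcomp Require Import all_classical all_reals all_analysis.
Import Order.TTheory GRing.Theory Num.Theory.
Import numFieldNormedType.Exports.

Set Implicit Arguments.
Unset Strict Implicit.
Unset Printing Implicit Defensive.

Local Open Scope classical_set_scope.
Local Open Scope ring_scope.
Local Open Scope card_scope.

(* A cardinal is represented by any type of that cardinality: sums are disjoint
   sums, powers are function types, and only comparisons up to injection are
   meaningful.  Classes of types are predicates [Type -> Prop] rather than
   [set Type], which would cause universe inconsistencies. *)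
Definition cardle (K L : Type) : bool := [set: K] #<= [set: L].
Definition cardlt (K L : Type) : bool := cardle K L && ~~ cardle L K.
Notation "K <=c L" := (cardle K L) (at level 70, no associativity).
Notation "K <c L" := (cardlt K L) (at level 70, no associativity).

Lemma cardle_inj (K L : Type) (f : K -> L) : injective f -> K <=c L.
Proof.
move=> fI; rewrite /cardle -(card_le_eql (inj_card_eq (f := f) (A := setT) _)).
  exact: subset_card_le.
by move=> x y _ _; exact: fI.
Qed.

Lemma cardleP (K L : Type) : reflect (exists f : K -> L, injective f) (K <=c L).
Proof.
apply: (iffP idP) => [/card_leP[f]|[f]]; last exact: cardle_inj.
exists (fun x => set_val (f (to_setT x))) => x y /val_inj fxy.
have /(congr1 set_val) : to_setT x = to_setT y.
  by apply: (@inj _ _ _ f) => //; rewrite inE.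
by [].
Qed.

Lemma cardle_trans (L K M : Type) : K <=c L -> L <=c M -> K <=c M.
Proof. exact: card_le_trans. Qed.

(* The pointwise-disjoint sets of sections of [G], ordered by inclusion, have a
   maximal element; one of its projections is onto. *)
Lemma cardle_minimum (J : Type) (G : J -> Type) :
  inhabited J -> exists j, forall k, G j <=c G k.
Proof.
move=> [j0].
pose P (M : set (forall j, G j)) :=
  forall f g, M f -> M g -> (exists j, f j = g j) -> f = g.
have [|M [PM maxM]] := @Zorn_bigcup _ P.
  move=> F FP Ftot f g [A FA Af] [B FB Bg] fg.
  have [AB|BA] := Ftot _ _ FA FB.
    by apply: (FP _ FB) => //; exact: AB.
  by apply: (FP _ FA) => //; exact: BA.
have [[j jsurj]|nsurj] :=
    pselect (exists j, forall y : G j, exists2 f, M f & f j = y).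
  exists j => k; pose s y := projT1 (cid2 (jsurj y)).
  have Ms y : M (s y) by rewrite /s; case: cid2.
  have sj y : s y j = y by rewrite /s; case: cid2.
  apply: (@cardle_inj _ _ (fun y => s y k)) => x y sxy.
  by rewrite -[x]sj -[y]sj; congr (_ j); apply: PM => //; exists k.
have {nsurj} h j : {y : G j | forall f, M f -> f j <> y}.
  apply: cid; apply: contrapT => hN; apply: nsurj; exists j => y.
  apply: contrapT => yN; apply: hN; exists y => f Mf fy.
  by apply: yN; exists f.
pose h0 j := projT1 (h j).
have hN f j : M f -> f j <> h0 j by move=> Mf; exact: projT2 (h j) f Mf.
exfalso; apply: (maxM (h0 |` M)).
  split; first by move=> f Mf; right.
  by move=> /(_ h0 (or_introl erefl)) Mh; exact: (hN _ j0 Mh).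
move=> f g [->|Mf] [->|Mg] // [j fg].
- by case: (hN _ j Mg).
- by case: (hN _ j Mf).
- by apply: PM => //; exists j.
Qed.

Lemma cardle_total (K L : Type) : K <=c L \/ L <=c K.
Proof.
have [b bP] := @cardle_minimum bool (fun b => if b then K else L)
  (inhabits true).
by case: b bP => bP; [left; exact: bP false | right; exact: bP true].
Qed.

Lemma cardle_minimum_pred (I : Type) (P : I -> Prop) (F : I -> Type) :
  (exists i, P i) -> exists2 i, P i & forall j, P j -> F i <=c F j.
Proof.
move=> [i0 Pi0].
pose J := {S : F i0 -> Prop | exists2 i, P i &
  {x : F i0 | S x} <=c F i /\ F i <=c {x : F i0 | S x}}.
have mkJ j : P j -> F j <=c F i0 -> exists S : J,
    {x | projT1 S x} <=c F j.
  move=> Pj /cardleP[f fI]; pose S x := exists y, f y = x.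
  have h1 : {x : F i0 | S x} <=c F j.
    pose g (u : {x : F i0 | S x}) : F j := projT1 (cid (projT2 u)).
    apply: (@cardle_inj _ _ g).
    move=> [x Sx] [y Sy]; rewrite /g /=; case: cid => a ax; case: cid => b bY.
    by move=> /= ab; apply: eq_exist; rewrite -ax -bY ab.
  have h2 : F j <=c {x : F i0 | S x}.
    apply: (@cardle_inj _ _ (fun y => exist S (f y) (ex_intro _ y erefl))).
    by move=> x y [] /fI.
  by exists (exist _ S (ex_intro2 _ _ j Pj (conj h1 h2))).
have [S0 _] := mkJ _ Pi0 (card_lexx _).
have [[S [i Pi [Si iS]]] minS] :=
  @cardle_minimum J (fun S => {x | projT1 S x}) (inhabits S0).
have imin j : P j -> F j <=c F i0 -> F i <=c F j.
  move=> Pj /(mkJ _ Pj)[T Tj].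
  exact: cardle_trans iS (cardle_trans (minS T) Tj).
exists i => // j Pj; have [ji|ij] := cardle_total (F j) (F i0).
  exact: imin.
by apply: cardle_trans ij; exact: imin (card_lexx _).
Qed.

(* [min {F i | P i}], the empty type if no [i] satisfies [P] *)
Definition cardmin (I : Type) (P : I -> Prop) (F : I -> Type) : Type :=
  match pselect (exists i, P i) with
  | left ex => F (s2val (cid2 (cardle_minimum_pred F ex)))
  | right _ => void
  end.

(* [sup {F i | P i}], as the least upper bound *)
Definition cardsup (I : Type) (P : I -> Prop) (F : I -> Type) : Type :=
  cardmin (fun K : Type => forall i, P i -> F i <=c K) id.

Lemma cardminP (I : Type) (P : I -> Prop) (F : I -> Type) :
  (exists i, P i) -> exists2 i, P i & cardmin P F = F i.
Proof.
move=> Pex; rewrite /cardmin; case: pselect => // ex.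
set c := cid2 _; exists (s2val c) => //; exact: s2valP c.
Qed.

Lemma cardmin_le (I : Type) (P : I -> Prop) (F : I -> Type) i :
  P i -> cardmin P F <=c F i.
Proof.
move=> Pi; rewrite /cardmin; case: pselect => [ex|[]]; last by exists i.
exact: s2valP' (cid2 (cardle_minimum_pred F ex)) i Pi.
Qed.

Lemma cardsup_ub (I : Type) (P : I -> Prop) (F : I -> Type) (K : Type) :
  (forall i, P i -> F i <=c K) -> forall i, P i -> F i <=c cardsup P F.
Proof.
move=> FK i Pi; rewrite /cardsup.
have [L Lub ->] := @cardminP Type (fun K => forall i, P i -> F i <=c K) id
  (ex_intro _ K FK).
exact: Lub.
Qed.

Lemma cardsup_le (I : Type) (P : I -> Prop) (F : I -> Type) (K : Type) :
  (forall i, P i -> F i <=c K) -> cardsup P F <=c K.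
Proof. exact: cardmin_le. Qed.

Lemma cardsup_sub (I : Type) (P : I -> Prop) (F : I -> Type) i :
  P i -> F i <=c cardsup P F.
Proof.
apply: (@cardsup_ub _ _ _ {i : I & F i}) => {}i _.
apply: (@cardle_inj _ _ (existT F i)) => x y xy.
have := projT2_eq xy.
by rewrite (Prop_irrelevance (projT1_eq xy) erefl).
Qed.

Lemma cardlt_set (T : Type) : T <c set T.
Proof.
apply/andP; split.
  apply: (@cardle_inj _ _ (fun x : T => [set x])) => x y /(congr1 (@^~ x)) /= xy.
  by have : x = y by rewrite -xy.
apply/negP => /cardleP[f fI]; pose D := [set f A | A in [set A | ~ A (f A)]].
have nDf : ~ D (f D) by move=> D'; case: (D') => A /= + /fI AD; rewrite AD.
by apply: (nDf); exists D.
Qed.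

Lemma cardle_lt_trans (L K M : Type) : K <=c L -> L <c M -> K <c M.
Proof.
move=> KL /andP[LM /negP nML]; apply/andP; split; first exact: cardle_trans LM.
by apply/negP => MK; apply: nML; exact: cardle_trans KL.
Qed.

(* [kappa ^< lambda] *)
Definition powlt (kappa lambda : Type) : Type :=
  cardsup (fun m : Type => m <c lambda) (fun m => m -> kappa).
Notation "kappa ^<c lambda" := (powlt kappa lambda)
  (at level 29, left associativity).

Lemma powlt_ub (kappa lambda m : Type) :
  inhabited kappa -> m <c lambda -> (m -> kappa) <=c kappa ^<c lambda.
Proof.
move=> [k0]; apply: (@cardsup_ub _ _ (fun m => m -> kappa) (lambda -> kappa)).
move=> {}m /andP[/cardleP[g gI] _].
pose ext (h : m -> kappa) (l : lambda) :=
  if pselect (exists x, g x = l) is left ex then h (projT1 (cid ex)) else k0.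
apply: (@cardle_inj _ _ ext) => h1 h2 h12; apply/funext => x.
move: (congr1 (@^~ (g x)) h12); rewrite /ext; case: pselect => [ex|[]].
  by case: cid => y /= /gI ->.
by exists x.
Qed.

Definition is_network (T : topologicalType) (N : set (set T)) :=
  forall (x : T) (U : set T), open U -> U x ->
    exists2 A, N A & A x /\ A `<=` U.

Definition nw (T : topologicalType) : Type :=
  (nat + cardmin (@is_network T) (fun N => set_type N))%type.

Definition weight (T : topologicalType) : Type :=
  (nat + cardmin (@basis T) (fun D => set_type D))%type.

Definition open_cover (Y : topologicalType) (U : set (set Y)) :=
  U `<=` open /\ \bigcup_(A in U) A = setT.

Definition subcovers_lt (Y : topologicalType) (m : Type) :=
  forall U : set (set Y), open_cover U -> exists2 V, V `<=` U &
    \bigcup_(A in V) A = setT /\ set_type V <c m.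

Lemma subcovers_lt_ex (Y : topologicalType) : exists m, subcovers_lt Y m.
Proof.
exists (set (set Y)) => U [_ covU]; exists U => //; split => //.
apply: cardle_lt_trans (cardlt_set _).
by apply: (@cardle_inj _ _ set_val); exact: val_inj.
Qed.

Definition delta (Y : topologicalType) : Type :=
  (nat + cardmin (subcovers_lt Y) id)%type.

(* Finite unions include the empty one, so [bset set0] holds even when [X] is
   empty. *)
Record bornology (X : Type) := Bornology {
  bset :> set (set X) ;
  bornology_sub : forall A B, bset B -> A `<=` B -> bset A ;
  bornology_bigcup : forall F : set (set X), finite_set F -> F `<=` bset ->
    bset (\bigcup_(A in F) A) ;
  bornology_cover : \bigcup_(A in bset) A = setT
}.

Lemma bornology0 (X : Type) (B : bornology X) : bset B set0.
Proof.
rewrite -(bigcup_set0 (idfun : set X -> set X)).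
by apply: bornology_bigcup => //; exact: finite_set0.
Qed.

Lemma bornologyU (X : Type) (B : bornology X) (A1 A2 : set X) :
  bset B A1 -> bset B A2 -> bset B (A1 `|` A2).
Proof.
move=> B1 B2; rewrite -(bigcup2E A1 A2).
have -> : \bigcup_i bigcup2 A1 A2 i = \bigcup_(A in [set A1; A2]) A.
  rewrite bigcup2E; apply/seteqP; split=> x.
    by case=> ?; [exists A1 => //; left|exists A2 => //; right].
  by move=> [A [->|->] Ax]; [left|right].
apply: bornology_bigcup; first exact: finite_set2.
by move=> A [->|->].
Qed.

Definition has_closed_base (X : topologicalType) (B : bornology X) :=
  exists2 B0 : set (set X), B0 `<=` bset B & B0 `<=` closed /\
    (forall A, bset B A -> exists2 A0, B0 A0 & A `<=` A0).

Definition is_bornology_network (X : topologicalType) (B : bornology X)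
    (gamma : set (set X)) :=
  forall A U, bset B A -> open U -> closure A `<=` U ->
    exists2 C, gamma C & closure A `<=` C /\ C `<=` U.

Definition bornology_nw (X : topologicalType) (B : bornology X) : Type :=
  (nat + cardmin (is_bornology_network B) (fun gamma => set_type gamma))%type.

(* [closure A : Type] carries the subspace topology. *)
Definition bornology_delta (X : topologicalType) (B : bornology X) : Type :=
  cardsup (bset B) (fun A => delta (set_type (closure A))).

(* The alias hides the topology that the library puts on [continuousType]. *)
Definition Cborn (R : realType) (X : topologicalType) (B : bornology X) :
  Type := continuousType X R.

Section tau.
Context {R : realType} {X : topologicalType} (B : bornology X).

HB.instance Definition _ := Choice.copy (Cborn R B) (continuousType X R).

Definition Cborn_fun (f : Cborn R B) : X -> R := (f : continuousType X R).

Definition basic_entourage (A : set X) (e : R) : set (Cborn R B * Cborn R B) :=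
  [set fg | forall x, A x -> `|Cborn_fun fg.1 x - Cborn_fun fg.2 x| < e].

Definition Cborn_entourage : set_system (Cborn R B * Cborn R B) :=
  filter_from [set Ae : set X * R | bset B Ae.1 /\ 0 < Ae.2]
    (fun Ae => basic_entourage Ae.1 Ae.2).

Let entourage_filter : Filter Cborn_entourage.
Proof.
apply: filter_from_filter; first by exists (set0, 1); split => //; exact: bornology0.
move=> [A1 e1] [A2 e2] [/= B1 e10] [/= B2 e20].
exists (A1 `|` A2, Num.min e1 e2).
  by split => /=; [exact: bornologyU|rewrite lt_min e10].
by move=> fg /= h; split=> x Ax; have := h x; rewrite lt_min => h';
  [have /andP[] := h' (or_introl Ax)|have /andP[] := h' (or_intror Ax)].
Qed.

Let entourage_diagonal E : Cborn_entourage E -> diagonal `<=` E.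
Proof.
move=> [[A e] [/= BA e0] AE] [f g] fg; apply: AE => x Ax /=.
by rewrite (fg : f = g) subrr normr0.
Qed.

Let entourage_inv E : Cborn_entourage E -> Cborn_entourage (E^-1)%relation.
Proof.
move=> [[A e] BAe AE]; exists (A, e) => // -[f g] h; apply: AE => x Ax /=.
by rewrite distrC; exact: h.
Qed.

Let entourage_split_ex E : Cborn_entourage E ->
  exists2 D, Cborn_entourage D & (D \; D `<=` E)%relation.
Proof.
move=> [[A e] [/= BA e0] AE].
exists (basic_entourage A (e / 2)).
  by exists (A, e / 2) => //; split => //=; rewrite divr_gt0.
move=> [f g] [h /= fh hg]; apply: AE => x Ax /=.
rewrite (splitr e) (le_lt_trans (ler_distD (Cborn_fun h x) _ _))//.
by rewrite ltrD// ?fh ?hg.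
Qed.

HB.instance Definition _ := isUniform.Build (Cborn R B)
  entourage_filter entourage_diagonal entourage_inv entourage_split_ex.

End tau.

(* Main.v *)
(* Lower bound: a network [N] of [C(X)] yields the [B]-network of the sets
   [{x | g x < 1/2 for all g in M}], [M in N], because a Urysohn function [f]
   vanishing on [closure A] and equal to [1] off [U] has some [M] with
   [f in M] between itself and its [(closure A, 1/2)]-neighbourhood.

   Upper bound: let [D] be a base of [X] of size [w].  Covering [closure A] by
   fewer than [delta] sets [O] of [D] on which [f] takes its values in a short
   rational interval [I], the functions [g] with [g(O)] in [I] for all these
   pairs [(O, I)] form a set that contains [f] and lies in its
   [(A, e)]-neighbourhood.  The network so obtained is indexed by the subsets of
   size [< delta] of a set of size [w], and there are at most [w ^< delta] of
   these: up to bijection every infinite subset is an initial segment of a well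
   order of [w], so that the subsets of infinite size are the ranges of
   functions on at most [w + 1] many domains. *)

Require Import Defs.
From HB Require Import structures.
From mathcomp Require Import all_boot all_order all_algebra.
From mathcomp Require Import all_classical all_reals all_analysis wochoice lra.
Import Order.TTheory GRing.Theory Num.Theory.
Import numFieldNormedType.Exports.

Set Implicit Arguments.
Unset Strict Implicit.
Unset Printing Implicit Defensive.

Local Open Scope classical_set_scope.
Local Open Scope ring_scope.
Local Open Scope card_scope.

(** * Comparison of cardinals: codes, images, sums and products *)

(** An element may have several codes: choice picks one, and no two elements share a code.
    Injections out of subset types can thus be given by a relation. *)
Lemma cardle_code (A B : Type) (r : A -> B -> Prop) :
  (forall a, exists b, r a b) ->
  (forall a1 a2 b, r a1 b -> r a2 b -> a1 = a2) -> A <=c B.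
Proof.
move=> rex rinj; pose f a := projT1 (cid (rex a)).
have rf a : r a (f a) by rewrite /f; case: cid.
apply: (@cardle_inj _ _ f) => a1 a2 fE.
by apply: (rinj _ _ (f a1)); rewrite // fE.
Qed.

Lemma set_val_ex (T : Type) (A : set T) x : A x -> exists a : A, set_val a = x.
Proof. by move=> Ax; exists (SigSub (mem_set Ax)). Qed.

Lemma cardle_set_val (T : Type) (A : set T) : set_type A <=c T.
Proof. by apply: (@cardle_inj _ _ set_val) => x y /val_inj. Qed.

Lemma cardle_image (I T : Type) (f : I -> T) (A : set I) :
  set_type (f @` A) <=c set_type A.
Proof.
apply: (@cardle_code _ _ (fun y x => set_val y = f (set_val x))).
  move=> y; have [x Ax fx] := set_valP y.
  by have [a aE] := set_val_ex Ax; exists a; rewrite aE.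
by move=> y1 y2 x <- /val_inj.
Qed.

Lemma cardle_range (I T : Type) (f : I -> T) :
  injective f -> I <=c set_type (range f).
Proof.
move=> fI; apply: (@cardle_code _ _ (fun i z => set_val z = f i)).
  by move=> i; exact: set_val_ex (imageT f i).
by move=> i1 i2 z -> /fI.
Qed.

Lemma cardle_setT (T : Type) : T <=c set_type [set: T].
Proof.
apply: (@cardle_code _ _ (fun x a => set_val a = x)).
  by move=> x; exact: set_val_ex.
by move=> x y a <-.
Qed.

Lemma cardle_prod (A B C D : Type) :
  A <=c C -> B <=c D -> (A * B)%type <=c (C * D)%type.
Proof.
move=> /cardleP[f fI] /cardleP[g gI].
apply: (@cardle_inj _ _ (fun x => (f x.1, g x.2))).
by move=> [a b] [a' b'] [/fI -> /gI ->].
Qed.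

Lemma cardle_sum (A B C D : Type) :
  A <=c C -> B <=c D -> (A + B)%type <=c (C + D)%type.
Proof.
move=> /cardleP[f fI] /cardleP[g gI].
apply: (@cardle_inj _ _ (fun x => match x with
  | inl a => inl (f a) | inr b => inr (g b) end)).
by move=> [a|b] [a'|b'] // [] => [/fI|/gI] ->.
Qed.

Lemma cardle_addr (A B : Type) : A <=c (B + A)%type.
Proof. by apply: (@cardle_inj _ _ inr) => x y []. Qed.

Lemma cardle_addl (A B : Type) : A <=c (A + B)%type.
Proof. by apply: (@cardle_inj _ _ inl) => x y []. Qed.

Lemma cardle_countType (T : countType) : T <=c nat.
Proof. exact: (@cardle_inj _ _ pickle (pcan_inj pickleK)). Qed.

Lemma cardle_sum_square (T : Type) :
  nat <=c T -> (T * T)%type <=c T -> (T + T)%type <=c T.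
Proof.
move=> /cardleP[f fI]; apply: cardle_trans.
apply: (@cardle_inj _ _ (fun x => match x with
  | inl a => (f 0, a) | inr b => (f 1, b) end)).
by move=> [a|b] [a'|b'] // [] => [->|/fI|/fI|->].
Qed.

Lemma cardle_sum_of (A B T : Type) : nat <=c T -> (T * T)%type <=c T ->
  A <=c T -> B <=c T -> (A + B)%type <=c T.
Proof.
move=> nT TT AT BT.
exact: cardle_trans (cardle_sum AT BT) (cardle_sum_square nT TT).
Qed.

Lemma cardle_prod_of (A B T : Type) : (T * T)%type <=c T ->
  A <=c T -> B <=c T -> (A * B)%type <=c T.
Proof. by move=> TT AT BT; exact: cardle_trans (cardle_prod AT BT) TT. Qed.

Lemma cardle_option (A T : Type) : nat <=c T -> (T * T)%type <=c T ->
  A <=c T -> option A <=c T.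
Proof.
move=> nT TT AT; apply: (@cardle_trans (unit + A)).
  apply: (@cardle_inj _ _ (fun x => if x is Some a then inr a else inl tt)).
  by move=> [a|] [b|] // [->].
apply: cardle_sum_of => //; apply: cardle_trans nT.
exact: cardle_countType.
Qed.

Lemma cardle_setU (T : Type) (A B : set T) :
  set_type (A `|` B) <=c (set_type A + set_type B)%type.
Proof.
apply: (@cardle_code _ _ (fun x s => match s with
  | inl a => set_val x = set_val a | inr b => set_val x = set_val b end)).
  move=> x; have [Ax|Bx] := set_valP x.
    by have [a aE] := set_val_ex Ax; exists (inl a); rewrite aE.
  by have [b bE] := set_val_ex Bx; exists (inr b); rewrite bE.
by move=> x y [a|b] <- /val_inj.
Qed.

(** * Squares of infinite cardinals *)

Section square.
Context {T : Type}.
Implicit Types (M : set (T * T * T)) (Z : set T).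

(** Read off the diagonal, so that [M] alone determines it and Zorn's lemma applies to graphs
    ordered by inclusion. *)
Let carrier M : set T := [set x | exists z, M (x, x, z)].

(* [M] is the graph of an injection of the square of [carrier M] into
   [carrier M]. *)
Let pairing M :=
  [/\ forall x y, (exists z, M (x, y, z)) <-> carrier M x /\ carrier M y,
      forall p z1 z2, M (p, z1) -> M (p, z2) -> z1 = z2,
      forall p1 p2 z, M (p1, z) -> M (p2, z) -> p1 = p2 &
      forall p z, M (p, z) -> carrier M z].

(** Each condition concerns at most two given triples, and these lie in a common member of the
    chain. *)
Let pairing_bigcup (F : set (set (T * T * T))) :
  F `<=` pairing -> total_on F subset -> pairing (\bigcup_(M in F) M).
Proof.
move=> FP Ftot.
have chain M1 M2 : F M1 -> F M2 -> exists2 M, F M & M1 `<=` M /\ M2 `<=` M.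
  move=> F1 F2; have [M12|M21] := Ftot _ _ F1 F2.
    by exists M2 => //; split=> // p.
  by exists M1 => //; split=> // p.
split.
- move=> x y; split.
    move=> [z [M FM Mz]]; have [M1 _ _ _] := FP _ FM.
    by have [[u ?] [v ?]] := (M1 x y).1 (ex_intro _ z Mz);
      split; [exists u|exists v]; exists M.
  move=> [[u [M1 F1 M1u]] [v [M2 F2 M2v]]].
  have [M FM [M1M M2M]] := chain _ _ F1 F2.
  have [h _ _ _] := FP _ FM.
  have [|z Mz] := (h x y).2; last by exists z, M.
  by split; [exists u; exact: M1M|exists v; exact: M2M].
- move=> p z1 z2 [M1 F1 h1] [M2 F2 h2].
  have [M FM [M1M M2M]] := chain _ _ F1 F2.
  by have [_ h _ _] := FP _ FM; apply: (h p); [exact: M1M|exact: M2M].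
- move=> p1 p2 z [M1 F1 h1] [M2 F2 h2].
  have [M FM [M1M M2M]] := chain _ _ F1 F2.
  by have [_ _ h _] := FP _ FM; apply: (h _ _ z); [exact: M1M|exact: M2M].
- move=> p z [M FM Mz]; have [_ _ _ h] := FP _ FM.
  by have [u ?] := h _ _ Mz; exists u, M.
Qed.

Let pairing_square M : pairing M ->
  (set_type (carrier M) * set_type (carrier M))%type <=c set_type (carrier M).
Proof.
move=> [h1 h2 h3 h4].
apply: (@cardle_code _ _
  (fun p z => M (set_val p.1, set_val p.2, set_val z))).
  move=> [x y] /=; have [|z Mz] := (h1 (set_val x) (set_val y)).2.
    by split; exact: set_valP.
  by have [c cE] := set_val_ex (h4 _ _ Mz); exists c; rewrite cE.
move=> [x1 y1] [x2 y2] z /= a b.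
by have [/val_inj -> /val_inj ->] := h3 _ _ _ a b.
Qed.

(** The pairs from the carrier and [Z] that are not pairs of the carrier are sent injectively into
    [Z], so the new values avoid those of [M], which lie in the carrier. *)
Let pairing_extend M Z : pairing M -> Z `<=` ~` carrier M ->
  nat <=c set_type Z -> (set_type Z * set_type Z)%type <=c set_type Z ->
  set_type (carrier M) <=c set_type Z ->
  exists2 M', M `<` M' & pairing M'.
Proof.
move=> PM ZM nZ ZZ YZ; set Y := carrier M in YZ *.
have UZ : set_type (Y `|` Z) <=c set_type Z.
  apply: cardle_trans (cardle_setU _ _) _.
  exact: cardle_sum_of (card_lexx _).
have /cardleP[h hI] := cardle_prod_of ZZ UZ UZ.
pose N : set (T * T * T) := [set pz | exists a b : set_type (Y `|` Z),
  [/\ pz = (set_val a, set_val b, set_val (h (a, b))) &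
      ~ (Y (set_val a) /\ Y (set_val b))]].
have [h1 h2 h3 h4] := PM.
have NE x y : Y x \/ Z x -> Y y \/ Z y -> ~ (Y x /\ Y y) ->
    exists2 z, Z z & N (x, y, z).
  move=> Ux Uy nxy.
  have [a xE] := @set_val_ex _ (Y `|` Z) _ Ux.
  have [b yE] := @set_val_ex _ (Y `|` Z) _ Uy.
  rewrite -xE -yE in nxy *; exists (set_val (h (a, b))).
    exact: set_valP.
  by exists a, b.
have NZ p z : N (p, z) -> Z z by move=> [a [b [[_ ->] _]]]; exact: set_valP.
have NN p z : M (p, z) -> ~ N (p, z).
  move=> Mz [a [b [pE]]]; apply.
  by apply/h1; exists z; move: Mz; case: pE => -> _.
have carr x : carrier (M `|` N) x <-> (Y `|` Z) x.
  split.
    move=> [z [Mz|[a [b [[-> _ _] _]]]]]; first by left; exists z.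
    exact: set_valP.
  move=> [[z Mz]|Zx]; first by exists z; left.
  by have [|||z _ Nz] := NE x x;
    [right|right|move=> [/(ZM _ Zx)]|exists z; right].
exists (M `|` N).
  split; first by move=> p; left.
  have /cardleP[g _] := nZ; pose x := g 0.
  have [|||z _ Nz] := NE (set_val x) (set_val x).
  - by right; exact: set_valP.
  - by right; exact: set_valP.
  - by move=> [/(ZM _ (set_valP x))].
  by move=> /(_ _ (or_intror Nz)) /NN.
split.
- move=> x y; split.
    move=> [z [Mz|[a [b [[-> -> _] _]]]]].
      by have [? ?] := (h1 x y).1 (ex_intro _ z Mz); split; apply/carr; left.
    by split; apply/carr; exact: set_valP.
  move=> [/carr Ux /carr Uy]; have [Yxy|nY] := pselect (Y x /\ Y y).
    by have [z Mz] := (h1 x y).2 Yxy; exists z; left.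
  by have [z _ Nz] := NE x y Ux Uy nY; exists z; right.
- move=> [x y] z1 z2 [m1|n1] [m2|n2].
  + exact: h2 m1 m2.
  + case: n2 => a [b [[xE yE _]]]; case; rewrite -xE -yE.
    by apply/h1; exists z1.
  + case: n1 => a [b [[xE yE _]]]; case; rewrite -xE -yE.
    by apply/h1; exists z2.
  + case: n1 n2 => a [b [[-> -> ->] _]] [a' [b' [[]]]].
    by move=> /val_inj -> /val_inj -> ->.
- move=> p1 p2 z [m1|n1] [m2|n2].
  + exact: h3 m1 m2.
  + by case: (ZM _ (NZ _ _ n2)); exact: h4 m1.
  + by case: (ZM _ (NZ _ _ n1)); exact: h4 m2.
  + case: n1 n2 => a [b [[-> ->] _]] [a' [b' [[->]]]].
    by move=> /val_inj /hI [-> ->].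
- move=> p z [m|n]; apply/carr; first by left; exact: h4 m.
  by right; exact: NZ n.
Qed.

(* By maximality the complement of the carrier is not larger than the carrier,
   so that the whole type embeds in two copies of it. *)
Lemma cardle_square : nat <=c T -> (T * T)%type <=c T.
Proof.
move=> nT; have [M [PM Mmax]] := Zorn_bigcup pairing_bigcup.
set Y := carrier M.
have YY := pairing_square PM; rewrite -/Y in YY.
have noext Z : Z `<=` ~` Y -> nat <=c set_type Z ->
    (set_type Z * set_type Z)%type <=c set_type Z ->
    ~ set_type Y <=c set_type Z.
  move=> ZY nZ ZZ YZ; have [M' MM' PM'] := pairing_extend PM ZY nZ ZZ YZ.
  exact: Mmax MM' PM'.
have TU : T <=c set_type (Y `|` ~` Y) by rewrite setUv; exact: cardle_setT.
have range_val (I : Type) (g : I -> ~` Y) : injective g ->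
    exists Z : set T, [/\ Z `<=` ~` Y, I <=c set_type Z & set_type Z <=c I].
  move=> gI; exists (range (set_val \o g)); split.
  - by move=> _ [i _ <-]; exact: set_valP.
  - by apply: cardle_range => x y /val_inj /gI.
  - exact: cardle_trans (cardle_image _ _) (cardle_set_val _).
(* For infinite [Y], either the complement is no larger and [T] embeds in [Y], or the complement
   contains a copy of [Y], which would extend [M]. *)
have [nY|Yn] := cardle_total nat (set_type Y).
  have [CY|YC] := cardle_total (set_type (~` Y)) (set_type Y).
    have TY : T <=c set_type Y.
      apply: cardle_trans TU (cardle_trans (cardle_setU _ _) _).
      exact: cardle_sum_of (card_lexx _) CY.
    apply: cardle_trans (cardle_prod TY TY) (cardle_trans YY _).
    exact: cardle_set_val.
  have /cardleP[g gI] := YC; have [Z [ZY YZ ZleY]] := range_val _ g gI.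
  case: (noext Z) => //; first exact: cardle_trans YZ.
  by apply: cardle_trans YZ; exact: cardle_prod_of.
(* For countable [Y], a countably infinite subset of the complement would extend [M]; if there is
   none, [T] itself is countable. *)
have [nC|Cn] := cardle_total nat (set_type (~` Y)).
  have /cardleP[g gI] := nC; have [Z [ZY nZ Zn]] := range_val _ g gI.
  case: (noext Z) => //; last exact: cardle_trans nZ.
  apply: cardle_trans nZ; apply: cardle_trans (cardle_prod Zn Zn) _.
  exact: cardle_countType.
have Tn : T <=c nat.
  apply: cardle_trans TU (cardle_trans (cardle_setU _ _) _).
  apply: cardle_trans (cardle_sum Yn Cn) _.
  exact: cardle_countType.
apply: cardle_trans (cardle_prod Tn Tn) (cardle_trans _ nT).
exact: cardle_countType.
Qed.

End square.

(** Lists are folded into single elements by an injection of [option (T * T)] into [T], with [None]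
    for the empty list. *)
Lemma cardle_seq (T : Type) : nat <=c T -> seq T <=c T.
Proof.
move=> nT; have TT := cardle_square nT.
have /cardleP[p pI] := cardle_option nT TT TT.
pose code := fix code (s : seq T) :=
  if s is x :: s' then p (Some (x, code s')) else p None.
apply: (@cardle_inj _ _ code).
by elim=> [|x s IH] [|y t] //= /pI // [-> /IH ->].
Qed.

(** * Well orders and initial segments *)

Lemma well_order_ex (W : Type) : exists2 R : W -> W -> Prop,
  (forall x y, R x y -> R y x -> x = y) &
  (forall A : set W, A !=set0 -> exists2 z, A z & forall x, A x -> R z x).
Proof.
have [R Rwo] := well_ordering_principle {classic W}.
exists R.
  move=> x y Rxy Ryx.
  apply: (@wo_chain_antisymmetric _ R predT) => //; last by rewrite Rxy.
  by move=> A _; exact: Rwo.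
move=> A [a Aa].
have [|z [[Az zA] _]] := Rwo [pred x : {classic W} | `[< A x >]].
  by exists a; exact/asboolP.
by exists z => [|x Ax]; [exact/asboolP|apply: zA; exact/asboolP].
Qed.

Section initial_segments.
Context {W : Type} {R : W -> W -> Prop}.
Hypothesis Ranti : forall x y, R x y -> R y x -> x = y.
Hypothesis Rmin : forall A : set W, A !=set0 ->
  exists2 z, A z & forall x, A x -> R z x.

(** For a well order [R], [~ R w' v] says that [v] lies strictly below [w']; [None] adds the whole
    type. *)
Definition segment (w : option W) : set W :=
  if w is Some w' then [set v | ~ R w' v] else setT.

(* If [S] embeds in the segment [D] but in no segment below an element of [D],
   its image is cofinal, so [D] is the union of at most [S] segments, each of
   which embeds in [S]. *)
Lemma cardle_segment (S : Type) : nat <=c S -> S <=c W ->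
  exists w, S <=c set_type (segment w) /\ set_type (segment w) <=c S.
Proof.
move=> nS SW.
(* [w] is the least point whose segment has room for [S], or [None] if no proper segment has. *)
have [w [Sw minw]] : exists w, S <=c set_type (segment w) /\
    forall v, segment w v -> ~ S <=c set_type (segment (Some v)).
  pose P := [set w | S <=c set_type (segment (Some w))].
  have [Pex|nP] := pselect (P !=set0).
    by have [w Pw minw] := Rmin Pex; exists (Some w); split=> // v nRwv /minw.
  exists None; split; last by move=> v _ Pv; apply: nP; exists v.
  exact: cardle_trans SW (cardle_setT _).
exists w; split=> //; have /cardleP[e eI] := Sw.
have seg_le s : set_type (segment (Some (set_val (e s)))) <=c S.
  have [/minw []|//] :=
    cardle_total S (set_type (segment (Some (set_val (e s))))).
  exact: set_valP.
pose i s := projT1 (cid (elimT (cardleP _ _) (seg_le s))).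
have iI s : injective (i s) by rewrite /i; case: cid.
apply: (@cardle_trans (S * option S)); last first.
  have SS := cardle_square nS.
  apply: (cardle_prod_of SS (card_lexx _)).
  exact: cardle_option nS SS (card_lexx _).
(* [None] marks [v] as the point [e s] itself; [Some t] records the place of [v] in the segment
   below [e s], embedded in [S] by [i s]. *)
apply: (@cardle_code _ _ (fun v p => match p.2 with
  | None => set_val v = set_val (e p.1)
  | Some t => exists2 u, set_val u = set_val v & i p.1 u = t end)).
(* Otherwise the image of [e] would lie strictly below [v], against the minimality of [w]. *)
- move=> v; have [s Rvs] : exists s, R (set_val v) (set_val (e s)).
    apply: contrapT => nex; apply: (minw (set_val v)); first exact: set_valP.
    apply: (@cardle_code _ _ (fun s a => set_val a = set_val (e s))).
      move=> s; apply: set_val_ex => /= Rvs.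
      by apply: nex; exists s.
    by move=> s1 s2 a -> /val_inj /eI.
  have [vE|nvE] := pselect (set_val v = set_val (e s)).
    by exists (s, None).
  have [|u uE] := @set_val_ex _ (segment (Some (set_val (e s)))) (set_val v).
    by move=> /= Rsv; apply: nvE; exact: Ranti.
  by exists (s, Some (i s u)); exists u.
- move=> v1 v2 [s [t|]] /=; last by move=> <- /val_inj.
  by move=> [u1 uv1 <-] [u2 + /iI u21]; rewrite u21 uv1 => /val_inj.
Qed.

End initial_segments.

(** * Counting small subsets *)

Lemma cardlt_le_trans (L K M : Type) : K <c L -> L <=c M -> K <c M.
Proof.
move=> /andP[KL /negP nLK] LM; apply/andP; split; first exact: cardle_trans LM.
by apply/negP => MK; apply: nLK; exact: cardle_trans MK.
Qed.

Lemma cardlt_unit (L : Type) : nat <=c L -> unit <c L.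
Proof.
move=> nL; apply/andP; split; first exact: cardle_trans (cardle_countType _) nL.
apply/negP => Lu; have /cardleP[f fI] := cardle_trans nL Lu.
by have : 0 = 1 :> nat by apply: fI; case: (f 0) (f 1) => [] [].
Qed.

Lemma cardle_const (I W : Type) : inhabited I -> W <=c (I -> W).
Proof.
by move=> [i]; apply: (@cardle_inj _ _ (fun w _ => w)) => x y /(congr1 (@^~ i)).
Qed.

(* The relation "[g : m -> W] enumerates [S]" codes [S] by a function once a
   domain of cardinality [S] is fixed; an initial segment serves as domain, and
   there are at most [W] of these. *)
Lemma cardle_small_sets (W L K : Type) : nat <=c W -> nat <=c L ->
  (forall m, m <c L -> (m -> W) <=c K) ->
  {S : set W | set_type S <c L} <=c K.
Proof.
move=> nW nL WK.
have WK1 : W <=c K.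
  by apply: cardle_trans (WK unit (cardlt_unit nL)); exact: cardle_const.
have nK := cardle_trans nW WK1; have KK := cardle_square nK.
have [R Ranti Rmin] := well_order_ex W.
pose seg w := set_type (@segment W R w).
(* One embedding per segment is fixed in advance; a segment that is too large gets a constant
   map. *)
have [i iI] : exists i : forall w, (seg w -> W) -> K,
    forall w, seg w <c L -> injective (i w).
  have ex w : exists i : (seg w -> W) -> K, seg w <c L -> injective i.
    have [/WK/cardleP[i iI]|nsL] := boolP (seg w <c L); first by exists i.
    by have /cardleP[g _] := nK; exists (fun=> g 0).
  by exists (fun w => projT1 (cid (ex w))) => w; case: cid.
apply: (@cardle_trans (seq W + option W * K)); last first.
  apply: cardle_sum_of => //.
    exact: cardle_trans (cardle_seq nW) WK1.
  exact: cardle_prod_of KK (cardle_option nK KK WK1) (card_lexx _).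
(* A finite set is coded by a list, an infinite one by a segment of its size and the code of an
   enumeration on that segment. *)
apply: (@cardle_code _ (seq W + option W * K) (fun S c => match c with
  | inl s => forall x : {classic W}, sval S x <-> x \in (s : seq {classic W})
  | inr wk => seg wk.1 <c L /\ exists2 g, range g = sval S & i wk.1 g = wk.2
  end)).
- move=> [S SL] /=; have [Sf|/infiniteP nS'] := pselect (finite_set S).
    have [s sE] := (finite_seqP (S : set {classic W})).1 Sf.
    by exists (inl s) => x /=; rewrite sE.
  have nS : nat <=c set_type S by rewrite /cardle (card_le_eqr (card_setT S)).
  have [w [Sw wS]] := cardle_segment Ranti Rmin nS (cardle_set_val S).
  have wL := cardle_lt_trans wS SL.
  have [g gE] : exists g : seg w -> W, range g = S.
    have /cardleP[f fI] := Sw; have /cardleP[x0 _] := nS.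
    (* [g] inverts the embedding [f] of [S]; points outside the image of [f] go to the element
       [x0 0] of [S], so the range stays in [S]. *)
    pose g (v : seg w) : W :=
      if pselect (exists x, f x = v) is left ex then set_val (projT1 (cid ex))
      else set_val (x0 0).
    exists g; apply/seteqP; split=> [_ [v _ <-]|x Sx].
      by rewrite /g; case: pselect => [ex|_]; exact: set_valP.
    have [a aE] := set_val_ex Sx; exists (f a) => //; rewrite /g.
    case: pselect => [ex|[]]; last by exists a.
    by case: cid => b /= /fI ->.
  by exists (inr (w, i w g)); split=> //; exists g.
- move=> [S1 L1] [S2 L2] [s|[w k]] /=.
    move=> E1 E2; apply: eq_exist; apply/seteqP.
    by split=> x; [move/E1/E2|move/E2/E1].
  move=> [wL [g1 gE1 <-]] [_ [g2 gE2 /(iI _ wL) g12]].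
  by apply: eq_exist; rewrite -gE1 -gE2 g12.
Qed.

(** * Attained minima, small subcovers and closures *)

Lemma nw_network (T : topologicalType) :
  exists2 N : set (set T), is_network N & nw T = (nat + N)%type.
Proof.
have [|N NT E] := @cardminP _ (@is_network T) (fun N => set_type N).
  by exists setT => x U oU Ux; exists U => //; split=> // y.
by exists N; rewrite // /nw E.
Qed.

Lemma nw_le (T : topologicalType) (N : set (set T)) :
  is_network N -> nw T <=c (nat + N)%type.
Proof. by move=> NT; apply: cardle_sum (card_lexx _) (cardmin_le _ NT). Qed.

Lemma weight_basis (T : topologicalType) :
  exists2 D : set (set T), basis D & weight T = (nat + D)%type.
Proof.
have [|D DT E] := @cardminP _ (@basis T) (fun D => set_type D).
  exists open; split=> // x U; rewrite nbhsE => -[V [oV Vx] VU].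
  by exists V.
by exists D; rewrite // /weight E.
Qed.

Lemma basis_open_nbhs (T : topologicalType) (D : set (set T)) (x : T)
    (U : set T) :
  basis D -> nbhs x U -> exists2 G, D G & G x /\ G `<=` U.
Proof. by move=> [_ Dx] /Dx[G [DG Gx] GU]; exists G. Qed.

(** The minimum defining [delta] is attained by some [m] that bounds subcovers strictly, and [m] is
    at most [delta Y]. *)
Lemma delta_subcover (Y : topologicalType) (U : set (set Y)) :
  open_cover U -> exists2 V, V `<=` U &
    \bigcup_(A in V) A = setT /\ set_type V <c delta Y.
Proof.
have [m Ym E] := @cardminP _ (subcovers_lt Y) id (subcovers_lt_ex Y).
move=> /Ym[V VU [Vcov Vm]]; exists V => //; split=> //.
have mD : m <=c delta Y by rewrite /delta E; exact: cardle_addr.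
exact: cardlt_le_trans Vm mD.
Qed.

Lemma bornology_closure (X : topologicalType) (B : bornology X) (A : set X) :
  has_closed_base B -> bset B A -> bset B (closure A).
Proof.
move=> [B0 B0B [B0cl B0base]] /B0base[A0 B0A0 AA0].
apply: bornology_sub (B0B _ B0A0) _.
by rewrite (closure_id A0).1; [exact: closureS|exact: B0cl].
Qed.

(** * Neighbourhoods in the space of continuous functions *)

Section Cborn_theory.
Context {R : realType} {X : topologicalType} {B : bornology X}.

Lemma Cborn_continuous (f : Cborn R B) : continuous (Cborn_fun f).
Proof. exact: (@cts_fun _ _ (f : continuousType X R)). Qed.

Lemma Cborn_ex (f : X -> R) : continuous f ->
  exists g : Cborn R B, Cborn_fun g = f.
Proof.
by move=> cf; exists (mkcts cf : continuousType X R).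
Qed.

Lemma nbhs_CbornP (f : Cborn R B) (U : set (Cborn R B)) :
  nbhs f U <-> exists A e, [/\ bset B A, 0 < e &
    [set g | basic_entourage A e (f, g)] `<=` U].
Proof.
split.
  move=> /nbhsP[E [[A e] /= [BA e0] AE] EU]; exists A, e; split=> // g fg.
  by apply: EU; apply/xsectionP; exact: AE.
move=> [A [e [BA e0 AU]]]; apply/nbhsP; exists (@basic_entourage R X B A e).
  by exists (A, e).
by move=> g /xsectionP; exact: AU.
Qed.

End Cborn_theory.

(** * The lower bound *)

Section lower_bound.
Context {R : realType} {X : metricType R} {B : bornology X}.

Let sublevel (M : set (Cborn R B)) : set X :=
  [set x | forall g, M g -> Cborn_fun g x < 2^-1].

Let sublevel_network (N : set (set (Cborn R B))) :
  has_closed_base B -> is_network N -> is_bornology_network B (sublevel @` N).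
Proof.
move=> hB NT A U BA oU AU.
(* Urysohn's lemma: a metric space is normal, and these two closed sets are disjoint. *)
have sep : uniform_separator (closure A) (~` U).
  apply: normal_uniform_separator.
  - exact: (@pseudometric_normal R).
  - exact: closed_closure.
  - exact: open_closedC.
  - by apply/disjoints_subset; rewrite setCK.
have [f0 [cf _ fA fU]] := (@uniform_separatorP _ R _ _).1 sep.
have [f fE] := @Cborn_ex _ _ B _ cf.
(* The closed base puts [closure A] in the bornology, so uniform closeness on it defines a
   neighbourhood. *)
have : nbhs f [set g | basic_entourage (closure A) 2^-1 (f, g)].
  apply/nbhs_CbornP; exists (closure A), 2^-1; split=> //.
  exact: bornology_closure.
rewrite nbhsE => -[V [oV Vf] VA].
have [M NM [Mf MV]] := NT f V oV Vf.
exists (sublevel M); first by exists M.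
split.
  move=> x Ax g /MV/VA/(_ x Ax) /=.
  rewrite fE (_ : f0 x = 0) ?sub0r ?normrN; last by apply: fA; exists x.
  exact: le_lt_trans (ler_norm _).
move=> x /(_ f Mf); rewrite fE => fx; apply: contrapT => nUx.
have f1 : f0 x = 1 by apply: fU; exists x.
by move: fx; rewrite f1; lra.
Qed.

Lemma bornology_nw_le :
  has_closed_base B -> bornology_nw B <=c nw (Cborn R B).
Proof.
move=> hB; have [N NT ->] := nw_network (Cborn R B).
apply: cardle_sum (card_lexx _) _.
apply: cardle_trans (cardmin_le _ (sublevel_network hB NT)) _.
exact: cardle_image.
Qed.

End lower_bound.

(** * The upper bound *)

Section upper_bound.
Context {R : realType} {X : topologicalType} {B : bornology X}.
Context {D : set (set X)} {W : Type} {j : D * (rat * rat) -> W}.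
Hypothesis (Dbasis : basis D) (jI : injective j).

(** The constraints are coded by points of [W] through [j], so that the network is indexed by
    subsets of [W]. *)
Let box (T : set W) : set (Cborn R B) := [set g | forall p, T (j p) ->
  forall x, set_val p.1 x -> ratr p.2.1 < Cborn_fun g x < ratr p.2.2].

Let box_nbhs (A : set X) (e : R) (f : Cborn R B) : bset B A -> 0 < e ->
  exists2 T, set_type T <c bornology_delta B &
    box T f /\ box T `<=` [set g | basic_entourage A e (f, g)].
Proof.
move=> BA e0.
pose good (p : D * (rat * rat)) := ratr p.2.2 - ratr p.2.1 < e /\
  forall x, set_val p.1 x -> ratr p.2.1 < Cborn_fun f x < ratr p.2.2.
pose trace (p : D * (rat * rat)) : set (closure A) :=
  set_val @^-1` (set_val p.1).
have Ucov : open_cover (trace @` good).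
  split.
    move=> _ [p _ <-]; apply: open_comp; last first.
      by apply: (Dbasis.1); exact: set_valP.
    by move=> y _; exact: initial_continuous.
  apply/seteqP; split=> // y _; pose x := set_val y.
  (* Less than [e / 2] on each side keeps the length of the interval below [e]. *)
  have [|q1 q1E] := @rat_in_itvoo R (Cborn_fun f x - e / 2) (Cborn_fun f x).
    by lra.
  have [|q2 q2E] := @rat_in_itvoo R (Cborn_fun f x) (Cborn_fun f x + e / 2).
    by lra.
  move: q1E q2E; rewrite !in_itv /= => /andP[q11 q12] /andP[q21 q22].
  have : nbhs x (Cborn_fun f @^-1` [set z | ratr q1 < z < ratr q2]).
    apply: Cborn_continuous; apply: open_nbhs_nbhs; split.
      rewrite (_ : [set _ | _] = `]ratr q1, ratr q2[%classic).
        exact: interval_open.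
      by apply/seteqP; split=> z /=; rewrite in_itv.
    by rewrite /= q12 q21.
  move=> /(basis_open_nbhs Dbasis)[G DG [Gx Gf]].
  have [d dE] := set_val_ex DG.
  exists (trace (d, (q1, q2))); last by rewrite /trace /= dE.
  exists (d, (q1, q2)) => //; split => /=; first by lra.
  by rewrite dE => z /Gf.
have [V VU [Vcov Vlt]] := delta_subcover Ucov.
(* Choosing one good pair for each member of the subcover keeps the set of codes no larger than
   [V]. *)
have pvP (v : V) : exists p, good p /\ trace p = set_val v.
  by have [p gp pE] := VU _ (set_valP v); exists p.
pose pv v := projT1 (cid (pvP v)).
have pv_good v : good (pv v) by rewrite /pv; case: cid => p [].
have pv_trace v : trace (pv v) = set_val v by rewrite /pv; case: cid => p [].
exists (range (j \o pv)).
  apply: cardle_lt_trans (cardle_image _ _) _.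
  apply: cardle_lt_trans (cardle_set_val _) _.
  exact: cardlt_le_trans Vlt (cardsup_sub (fun A => delta (closure A)) BA).
split.
  by move=> p [v _ /jI <-] x px; have [_] := pv_good v; apply.
move=> g gT x Ax /=.
have [y yE] := set_val_ex (subset_closure Ax).
have [G VG] : (\bigcup_(G in V) G) y by rewrite Vcov.
have [v <-] := set_val_ex VG; rewrite -pv_trace /trace /= yE => vx.
have [qe /(_ x vx)/andP[f1 f2]] := pv_good v.
have /andP[g1 g2] : ratr (pv v).2.1 < Cborn_fun g x < ratr (pv v).2.2.
  by apply: gT => //; exists v.
(* Both values at [x] lie in one interval of length less than [e]. *)
by rewrite ltr_norml; apply/andP; split; lra.
Qed.

Let box_network :
  is_network (box @` [set T | set_type T <c bornology_delta B]).
Proof.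
move=> f U oU Uf.
have /nbhs_CbornP[A [e [BA e0 AU]]] : nbhs f U by exact: open_nbhs_nbhs.
have [T Tlt [Tf TA]] := box_nbhs f BA e0.
by exists (box T); [exists T|split=> // g /TA/AU].
Qed.

Lemma nw_Cborn_small_sets : nw (Cborn R B) <=c
  (nat + [set T : set W | set_type T <c bornology_delta B])%type.
Proof.
apply: cardle_trans (nw_le box_network) _.
exact: cardle_sum (card_lexx _) (cardle_image _ _).
Qed.

End upper_bound.

Lemma nw_Cborn_le (R : realType) (X : topologicalType) (B : bornology X) :
  nw (Cborn R B) <=c weight X ^<c bornology_delta B.
Proof.
have nW : nat <=c weight X by exact: cardle_addl.
have nL : nat <=c bornology_delta B.
  (* The empty set is in the bornology, and its [delta] already contains [nat]. *)
  apply: cardle_trans (cardsup_sub (fun A => delta (closure A)) (bornology0 B)).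
  exact: cardle_addl.
have WK m : m <c bornology_delta B ->
    (m -> weight X) <=c weight X ^<c bornology_delta B.
  by apply: powlt_ub; exact: (inhabits (inl 0)).
have WK1 : weight X <=c weight X ^<c bornology_delta B.
  by apply: cardle_trans (WK unit (cardlt_unit nL)); exact: cardle_const.
have nK := cardle_trans nW WK1.
have [D DB WE] := weight_basis X.
(* The infinite cardinal [weight X] absorbs the countably many rational intervals. *)
have /cardleP[j jI] : (D * (rat * rat))%type <=c weight X.
  apply: cardle_prod_of (cardle_square nW) _ _.
    by rewrite WE; exact: cardle_addr.
  exact: cardle_trans (cardle_countType _) nW.
apply: cardle_trans (nw_Cborn_small_sets DB jI) _.
apply: (cardle_sum_of nK (cardle_square nK) nK).
apply: cardle_trans (cardle_small_sets nW nL WK).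
apply: (@cardle_code _ _ (fun S T => set_val S = sval T)).
  by move=> S; exists (exist _ (set_val S) (set_valP S)).
by move=> S1 S2 T <- /val_inj.
Qed.

Theorem theorem3p6 (R : realType) (X : metricType R) (B : bornology X)
    (hB : has_closed_base B) :
  bornology_nw B <=c nw (Cborn R B) /\
  nw (Cborn R B) <=c weight X ^<c bornology_delta B.
Proof. by split; [exact: bornology_nw_le|exact: nw_Cborn_le]. Qed.
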